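(* Let $k$ be a field and let $A$ be a basic finite-dimensional $k$-algebra with $\mathrm{rad}(A)^2=\{0\}$ and $A/\mathrm{rad}(A)$ separable over $k$. Let $$\Sigma=\begin{pmatrix}A/\mathrm{rad}(A)&\mathrm{rad}(A)\\0&A/\mathrm{rad}(A)\end{pmatrix}.$$ Then there is a surjective homomorphism of Lie algebras $$\varphi_A:\ \mathrm{HH}^1_{\mathrm{rad}}(A)\twoheadrightarrow\mathrm{HH}^1_{\mathrm{rad}}(\Sigma)$$ with solvable kernel. In particular, $\mathrm{HH}^1_{\mathrm{rad}}(\Sigma)$ is solvable if and only if $\mathrm{HH}^1_{\mathrm{rad}}(A)$ is solvable.
   Context: For a finite-dimensional algebra $B$ with Jacobson radical $\mathrm{rad}(B)$, $\mathrm{Der}_{\mathrm{rad}}(B)$ is the Lie algebra (under the commutator) of $k$-linear derivations $\delta$ of $B$ with $\delta(\mathrm{rad}(B))\subseteq\mathrm{rad}(B)$; $\mathrm{Inn}(B)=\{[b,-]:b\in B\}$ is the Lie ideal of inner derivations; $\mathrm{HH}^1_{\mathrm{rad}}(B)=\mathrm{Der}_{\mathrm{rad}}(B)/\mathrm{Inn}(B)$. Since $\mathrm{rad}(A)^2=0$, $\mathrm{rad}(A)$ is an $A/\mathrm{rad}(A)$-bimodule and $\Sigma$ is the corresponding triangular matrix algebra. *)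

(* Defs.v *)
From HB Require Import structures.
From mathcomp Require Import all_boot all_algebra falgebra ssrAC.
From mathcomp Require Import generic_quotient ring_quotient boolp.

Set Implicit Arguments.
Unset Strict Implicit.
Unset Printing Implicit Defensive.

Import GRing.Theory.
Local Open Scope ring_scope.
Local Open Scope quotient_scope.

Section SubspaceOfPredicate.
Variables (k : fieldType) (V : vectType k).

Definition is_subspace (P : V -> Prop) : Prop :=
  P 0 /\ forall a u v, P u -> P v -> P (a *: u + v).

Lemma subspace_ex (P : V -> Prop) :
  is_subspace P -> exists U : {vspace V}, forall v, v \in U <-> P v.
Proof.
move=> [P0 Plin].
pose good n := `[< exists2 U : {vspace V}, \dim U = n & forall v, v \in U -> P v >].
have ex : exists n, good n.
  by exists 0%N; apply/asboolP; exists 0%VS; rewrite ?dimv0 // => v /[!memv0] /eqP->.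
have bd n : good n -> (n <= \dim {: V})%N.
  by move=> /asboolP [U <- _]; rewrite dimvS ?subvf.
case: (ex_maxnP ex bd) => n /asboolP [U dU UP] nmax.
exists U => v; split=> [|Pv]; first exact: UP.
have: good (\dim (U + <[v]>)%VS).
  apply/asboolP; exists (U + <[v]>)%VS => // _ /memv_addP [u Uu [_ /vlineP [a ->] ->]].
  by rewrite addrC; apply: Plin => //; apply: UP.
move=> /nmax; rewrite -dU => dle.
have /eqP eU : U == (U + <[v]>)%VS by rewrite eqEdim addvSl.
by rewrite eU; apply: (subvP (addvSr _ _)); rewrite memv_line.
Qed.

Definition subspace (P : V -> Prop) (hP : is_subspace P) : {vspace V} :=
  sval (cid (subspace_ex hP)).

Lemma subspaceP (P : V -> Prop) (hP : is_subspace P) v :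
  v \in subspace hP <-> P v.
Proof. by rewrite /subspace; case: cid. Qed.

End SubspaceOfPredicate.

Definition vquot (k : fieldType) (V : vectType k) (U : {vspace V}) : Type :=
  Quotient.quot (pred_of_vspace U).

Section VectorQuotient.
Variables (k : fieldType) (V : vectType k) (U : {vspace V}).

HB.instance Definition _ := GRing.Zmodule.on (vquot U).

Definition vpi (v : V) : vquot U := \pi_(Quotient.quot (pred_of_vspace U)) v.
Definition vrepr (x : vquot U) : V :=
  repr (x : Quotient.quot (pred_of_vspace U)).

Lemma vreprK : cancel vrepr vpi. Proof. exact: reprK. Qed.

Lemma vpi_eq u v : (vpi u == vpi v) = (u - v \in U).
Proof. by rewrite /vpi Quotient.idealrBE. Qed.

Lemma vpiD : {morph vpi : u v / u + v}.
Proof. by move=> u v; rewrite /vpi; exact: Quotient.pi_add. Qed.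

Lemma vpi_repr v : vrepr (vpi v) - v \in U.
Proof. by rewrite -vpi_eq vreprK. Qed.

Definition vquot_scale (a : k) (x : vquot U) : vquot U := vpi (a *: vrepr x).

Lemma vpiZ a v : vpi (a *: v) = vquot_scale a (vpi v).
Proof.
by apply/eqP; rewrite eq_sym vpi_eq -scalerBr memvZ // vpi_repr.
Qed.

Fact vquot_scaleA a b x :
  vquot_scale a (vquot_scale b x) = vquot_scale (a * b) x.
Proof. by rewrite -[x]vreprK -!vpiZ scalerA. Qed.
Fact vquot_scale1 : left_id 1 vquot_scale.
Proof. by move=> x; rewrite -[x]vreprK -!vpiZ scale1r. Qed.
Fact vquot_scaleDr : right_distributive vquot_scale +%R.
Proof.
by move=> a x y; rewrite -[x]vreprK -[y]vreprK -vpiD -!vpiZ scalerDr vpiD.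
Qed.
Fact vquot_scaleDl x : {morph vquot_scale^~ x : a b / a + b}.
Proof. by move=> a b /=; rewrite -[x]vreprK -!vpiZ scalerDl vpiD. Qed.

HB.instance Definition _ := GRing.Zmodule_isLmodule.Build k (vquot U)
  vquot_scaleA vquot_scale1 vquot_scaleDr vquot_scaleDl.

Fact vpi_linear : linear vpi.
Proof. by move=> a u v; rewrite vpiD vpiZ. Qed.
HB.instance Definition _ := GRing.isSemilinear.Build k V (vquot U) _ vpi
  (GRing.semilinear_linear vpi_linear).

Lemma vpi_eq0 v : (vpi v == 0) = (v \in U).
Proof. by rewrite -(linear0 vpi) vpi_eq subr0. Qed.

Let compl_proj := daddv_pi (U^C)%VS U.

Let compl_projE u v : u - v \in U -> compl_proj u = compl_proj v.
Proof.
move=> uv; apply/eqP; rewrite -subr_eq0 -linearB /=.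
have := @daddv_pi_add _ _ U (U^C)%VS (u - v) (capv_compl U).
rewrite addv_complf memvf daddv_pi_id ?capv_compl // => /(_ isT) h.
by apply/eqP/(addrI (u - v)); rewrite addr0.
Qed.

Fact vquot_vect_iso : Vector.axiom (\dim (U^C)%VS) (vquot U).
Proof.
exists (fun x => \row_i coord (vbasis U^C) i (compl_proj (vrepr x))).
  move=> a x y; apply/rowP => i; rewrite !mxE -linearP -linearP; congr (coord _ _ _).
  by apply: compl_projE; rewrite -vpi_eq linearP /= !vreprK.
exists (fun r : 'rV_(\dim U^C) => vpi (\sum_i r 0 i *: (vbasis U^C)`_i)).
  move=> x; rewrite -[RHS]vreprK; apply/eqP; rewrite vpi_eq.
  rewrite (eq_bigr (fun i => coord (vbasis U^C) i (compl_proj (vrepr x)) *: (vbasis U^C)`_i)); last by move=> i _; rewrite mxE.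
  rewrite -coord_vbasis ?memv_pi //.
  have := @daddv_pi_add _ _ (U^C)%VS U (vrepr x).
  rewrite capvC capv_compl addvC addv_complf memvf => /(_ erefl isT).
  rewrite -/compl_proj => /(canRL (addrK _)) ->.
  by rewrite addrC addKr rpredN memv_pi.
move=> r; apply/rowP => i; rewrite mxE.
set s := \sum_i _.
have sU : s \in (U^C)%VS.
  by apply: rpred_sum => j _; rewrite rpredZ ?vbasis_mem ?memt_nth.
rewrite (compl_projE (vpi_repr s)) daddv_pi_id 1?capvC ?capv_compl //.
by rewrite coord_sum_free ?(basis_free (vbasisP _)).
Qed.

HB.instance Definition _ := Lmodule_hasFinDim.Build k (vquot U) vquot_vect_iso.

End VectorQuotient.

Record algIdeal (k : fieldType) (A : falgType k) := AlgIdeal {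
  ideal_vs :> {vspace A};
  ideal_mull : forall a x, x \in ideal_vs -> a * x \in ideal_vs;
  ideal_mulr : forall a x, x \in ideal_vs -> x * a \in ideal_vs;
  ideal_proper : 1 \notin ideal_vs
}.

Definition aquot (k : fieldType) (A : falgType k) (I : algIdeal A) : Type :=
  vquot I.

Section AlgebraQuotient.
Variables (k : fieldType) (A : falgType k) (I : algIdeal A).

HB.instance Definition _ := Vector.on (aquot I).

Definition api : {linear A -> aquot I} := @vpi k A I.
Definition arepr : aquot I -> A := @vrepr k A I.

Lemma areprK : cancel arepr api. Proof. exact: vreprK. Qed.
Lemma api_eq u v : (api u == api v) = (u - v \in (I : {vspace A})).
Proof. exact: vpi_eq. Qed.
Lemma api_repr v : arepr (api v) - v \in (I : {vspace A}).
Proof. exact: vpi_repr. Qed.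

Definition aquot_one : aquot I := api 1.
Definition aquot_mul (x y : aquot I) : aquot I := api (arepr x * arepr y).

Lemma api_mul u v : api (u * v) = aquot_mul (api u) (api v).
Proof.
apply/eqP; rewrite eq_sym api_eq.
have -> : arepr (api u) * arepr (api v) - u * v =
    (arepr (api u) - u) * arepr (api v) + u * (arepr (api v) - v).
  by rewrite mulrBl mulrBr addrA subrK.
by apply: rpredD; [apply: ideal_mulr|apply: ideal_mull]; apply: api_repr.
Qed.

Fact aquot_mulA : associative aquot_mul.
Proof.
move=> x y z; rewrite -[x]areprK -[y]areprK -[z]areprK.
by rewrite -!api_mul mulrA.
Qed.
Fact aquot_mul1r : left_id aquot_one aquot_mul.
Proof. by move=> x; rewrite -[x]areprK -api_mul mul1r. Qed.
Fact aquot_mulr1 : right_id aquot_one aquot_mul.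
Proof. by move=> x; rewrite -[x]areprK -api_mul mulr1. Qed.
Fact aquot_mulDl : left_distributive aquot_mul +%R.
Proof.
move=> x y z; rewrite -[x]areprK -[y]areprK -[z]areprK.
by rewrite -linearD -!api_mul mulrDl linearD.
Qed.
Fact aquot_mulDr : right_distributive aquot_mul +%R.
Proof.
move=> x y z; rewrite -[x]areprK -[y]areprK -[z]areprK.
by rewrite -linearD -!api_mul mulrDr linearD.
Qed.
Fact aquot_oner_neq0 : aquot_one != 0.
Proof. by rewrite -(linear0 api) api_eq subr0 ideal_proper. Qed.

HB.instance Definition _ := GRing.Zmodule_isNzRing.Build (aquot I)
  aquot_mulA aquot_mul1r aquot_mulr1 aquot_mulDl aquot_mulDr aquot_oner_neq0.

Lemma apiM : {morph api : u v / u * v}. Proof. exact: api_mul. Qed.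
Lemma api1 : api 1 = 1. Proof. by []. Qed.

Fact aquot_scalerAl a (x y : aquot I) : a *: (x * y) = (a *: x) * y.
Proof.
rewrite -[x]areprK -[y]areprK -apiM.
by rewrite -!(linearZ_LR api) -apiM scalerAl.
Qed.
HB.instance Definition _ := GRing.Lmodule_isLalgebra.Build k (aquot I)
  aquot_scalerAl.

Fact aquot_scalerAr a (x y : aquot I) : a *: (x * y) = x * (a *: y).
Proof.
rewrite -[x]areprK -[y]areprK -apiM.
by rewrite -!(linearZ_LR api) -apiM scalerAr.
Qed.
HB.instance Definition _ := GRing.Lalgebra_isAlgebra.Build k (aquot I)
  aquot_scalerAr.
HB.instance Definition _ := Algebra_isFalgebra.Build k (aquot I).

Lemma api_eq0 v : (api v == 0) = (v \in (I : {vspace A})).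
Proof. exact: vpi_eq0. Qed.

End AlgebraQuotient.

Section Radical.
Variables (k : fieldType) (A : falgType k).
Implicit Types (I M N : {vspace A}) (a x y : A).

(* Every right ideal of A is a k-subspace, since x * a%:A = a *: x. *)
Definition right_ideal I : Prop := forall x a, x \in I -> x * a \in I.

Definition maximal_right_ideal M : Prop :=
  [/\ right_ideal M, M <> fullv &
      forall N, right_ideal N -> (M <= N)%VS -> N = M \/ N = fullv].

Definition in_Jrad x : Prop := forall M, maximal_right_ideal M -> x \in M.

Fact in_Jrad_subspace : is_subspace in_Jrad.
Proof.
split=> [M _|a u v ru rv M hM]; first exact: mem0v.
by rewrite rpredD ?rpredZ ?ru ?rv.
Qed.

Definition Jrad_vs : {vspace A} := subspace in_Jrad_subspace.

Lemma Jrad_vsP x : x \in Jrad_vs <-> in_Jrad x.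
Proof. exact: subspaceP. Qed.

Fact rad_mulr a x : x \in Jrad_vs -> x * a \in Jrad_vs.
Proof.
move=> /Jrad_vsP rx; apply/Jrad_vsP => M hM.
by case: (hM) => rM _ _; apply/rM/rx.
Qed.

Fact rad_mull a x : x \in Jrad_vs -> a * x \in Jrad_vs.
Proof.
move=> /Jrad_vsP rx; apply/Jrad_vsP => M hM; case: (hM) => rM Mn1 Mmax.
case: (boolP (a \in M)) => [aM|aNM]; first exact: rM.
pose Ma := (amull a @^-1: M)%VS.
have MaE y : (y \in Ma) = (a * y \in M) by rewrite -memv_preim lfunE.
rewrite -MaE; apply: rx; split.
- by move=> y b; rewrite !MaE mulrA; apply: rM.
- move=> Maf; case/negP: aNM.
  by rewrite -[a]mulr1 -MaE Maf memvf.
move=> N rN /subvP MaN.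
case: (pselect (amull a @: N <= M)%VS) => [aNM'|aNM'].
  left; apply/vspaceP => y; apply/idP/idP => [yN|]; last exact: MaN.
  by rewrite MaE; apply: (subvP aNM'); rewrite -[a * y](lfunE (_ \*o idfun)) memv_img.
right; apply/vspaceP => y; rewrite memvf.
case: (Mmax (amull a @: N + M)%VS).
- move=> z b /memv_addP [_ /memv_imgP [n nN ->] [m mM ->]].
  rewrite lfunE /= mulrDl -mulrA memv_add ?rM //.
  by rewrite -[a * _](lfunE (_ \*o idfun)) memv_img ?rN.
- exact: addvSr.
- by move=> e; case: aNM'; rewrite -e addvSl.
move=> e.
have: a * y \in (amull a @: N + M)%VS by rewrite e memvf.
move=> /memv_addP [_ /memv_imgP [n nN ->] [m mM]]; rewrite lfunE /= => eay.
rewrite -[y](subrK n) rpredD // MaN // MaE mulrBr eay addrC.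
by rewrite addKr.
Qed.

Lemma maximal_right_ideal_ex : exists M, maximal_right_ideal M.
Proof.
pose good n := `[< exists2 M, \dim M = n & right_ideal M /\ M <> fullv >].
have full1 M : right_ideal M -> 1 \in M -> M = fullv.
  move=> rM M1; apply/vspaceP => x; rewrite memvf.
  by rewrite -[x]mul1r rM.
have ex : exists n, good n.
  exists 0%N; apply/asboolP; exists 0%VS; rewrite ?dimv0 //; split.
    by move=> x a; rewrite !memv0 => /eqP ->; rewrite mul0r.
  move=> e; have: (1 : A) \in fullv by rewrite memvf.
  by rewrite -e memv0 oner_eq0.
have bd n : good n -> (n <= \dim {: A})%N.
  by move=> /asboolP [M <- _]; rewrite dimvS ?subvf.
case: (ex_maxnP ex bd) => n /asboolP [M dM [rM Mn1]] nmax.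
exists M; split=> // N rN sMN.
case: (pselect (N = fullv)) => [|Nn1]; [by right|left].
apply/esym/eqP; rewrite eqEdim sMN dM nmax //.
by apply/asboolP; exists N.
Qed.

Fact rad_proper : 1 \notin Jrad_vs.
Proof.
apply/negP => /Jrad_vsP r1; have [M hM] := maximal_right_ideal_ex.
case: (hM) => rM Mn1 _; apply: Mn1; apply/vspaceP => x.
by rewrite memvf -[x]mul1r rM ?r1.
Qed.

Definition Jrad : algIdeal A := AlgIdeal rad_mull rad_mulr rad_proper.

End Radical.

Arguments Jrad {k} A.

Section Basic.
Variables (k : fieldType) (A : falgType k).

Definition primitive_idem (e : A) : Prop :=
  [/\ e != 0, e * e = e &
      forall f g : A, f * f = f -> g * g = g -> f * g = 0 -> g * f = 0 ->
        e = f + g -> f = 0 \/ g = 0].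

Definition principal_right (e : A) : {vspace A} := (amull e @: fullv)%VS.

(* A linear map between subspaces of A always extends to A, so it is given as
   an element of 'End(A) of which only the restriction to U matters. *)
Definition right_module_iso (U V : {vspace A}) : Prop :=
  exists f : 'End(A),
    [/\ (f @: U = V)%VS, {in U &, injective f} &
        forall u a, u \in U -> f (u * a) = f u * a].

Definition basic : Prop :=
  exists (n : nat) (e : 'I_n -> A),
    [/\ forall i, primitive_idem (e i),
        forall i j, i != j -> e i * e j = 0,
        \sum_i e i = 1 &
        forall i j, i != j ->
          ~ right_module_iso (principal_right (e i)) (principal_right (e j))].

End Basic.

Arguments basic {k} A.

(* The tensor product over k of U and V, in the coordinates given by the
   canonical bases of U and V; tens_liftE is its universal property. *)
Definition tensor (k : fieldType) (U V : vectType k) : Type :=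
  'M[k]_(\dim {: U}, \dim {: V}).

Section Tensor.
Variables (k : fieldType) (U V : vectType k).

HB.instance Definition _ := Vector.on (tensor U V).

Definition tens (u : U) (v : V) : tensor U V :=
  \matrix_(i, j) (coord (vbasis {: U}) i u * coord (vbasis {: V}) j v).

Definition tens_lift (W : vectType k) (f : U -> V -> W) (t : tensor U V) : W :=
  \sum_i \sum_j t i j *: f (vbasis {: U})`_i (vbasis {: V})`_j.

Lemma tens_linearl v : linear (tens^~ v).
Proof.
by move=> a x y; apply/matrixP => i j; rewrite !mxE linearP mulrDl mulrA.
Qed.

Lemma tens_linearr u : linear (tens u).
Proof.
by move=> a x y; apply/matrixP => i j; rewrite !mxE linearP mulrDr mulrCA.
Qed.

Fact tens_lift_linear (W : vectType k) (f : U -> V -> W) :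
  linear (tens_lift f).
Proof.
move=> a s t; rewrite /tens_lift scaler_sumr -big_split; apply: eq_bigr => i _.
rewrite scaler_sumr -big_split; apply: eq_bigr => j _ /=.
by rewrite !mxE scalerDl scalerA.
Qed.
HB.instance Definition _ (W : vectType k) (f : U -> V -> W) :=
  GRing.isSemilinear.Build k (tensor U V) W _ (tens_lift f)
    (GRing.semilinear_linear (tens_lift_linear f)).

Lemma tens_liftE (W : vectType k) (f : U -> V -> W) u v :
  (forall y, linear (f^~ y)) -> (forall x, linear (f x)) ->
  tens_lift f (tens u v) = f u v.
Proof.
move=> fl fr.
have [f0l f0r] : (forall y, f 0 y = 0) /\ (forall x, f x 0 = 0).
  split=> x.
    by have := fl x (-1) 0 0; rewrite scaler0 addr0 scaleN1r addNr.
  by have := fr x (-1) 0 0; rewrite scaler0 addr0 scaleN1r addNr.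
have suml (I : finType) (c : I -> k) (b : I -> U) y :
    f (\sum_i c i *: b i) y = \sum_i c i *: f (b i) y.
  apply: (big_rec2 (fun s t => f s y = t)) => [|i t s _ <-]; first exact: f0l.
  exact: fl.
have sumr (I : finType) (c : I -> k) (b : I -> V) x :
    f x (\sum_i c i *: b i) = \sum_i c i *: f x (b i).
  apply: (big_rec2 (fun s t => f x s = t)) => [|i t s _ <-]; first exact: f0r.
  exact: fr.
rewrite {2}(coord_vbasis (memvf u)) {2}(coord_vbasis (memvf v)) suml.
apply: eq_bigr => i _; rewrite sumr scaler_sumr; apply: eq_bigr => j _.
by rewrite mxE scalerA.
Qed.

Lemma tensor_expand (t : tensor U V) : t = tens_lift tens t.
Proof.
apply/matrixP => i j; rewrite /tens_lift summxE (bigD1 i) //= summxE (bigD1 j) //=.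
have fU := basis_free (vbasisP {: U}); have fV := basis_free (vbasisP {: V}).
rewrite !mxE !coord_free // !eqxx !mulr1 !big1 ?addr0 //.
  move=> i' ni; rewrite summxE big1 // => j' _.
  by rewrite !mxE coord_free // (negPf ni) mul0r mulr0.
by move=> j' nj; rewrite !mxE !coord_free // (negPf nj) !mulr0.
Qed.

End Tensor.

Section Separable.
Variables (k : fieldType) (B : falgType k).

Definition tens_mult (t : tensor B B) : B := tens_lift *%R t.

Definition tens_bimul (a c : B) (t : tensor B B) : tensor B B :=
  tens_lift (fun x y => tens (a * x) (y * c)) t.

Lemma tens_multE x y : tens_mult (tens x y) = x * y.
Proof.
apply: tens_liftE => z b u v; first by rewrite mulrDl scalerAl.
by rewrite mulrDr scalerAr.
Qed.

Lemma tens_bimulE a c x y : tens_bimul a c (tens x y) = tens (a * x) (y * c).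
Proof.
apply: tens_liftE => z b u v; first by rewrite mulrDr -scalerAr tens_linearl.
by rewrite mulrDl -scalerAl tens_linearr.
Qed.

(* The multiplication B (x) B -> B splits as a map of B-bimodules. *)
Definition separable_algebra : Prop :=
  exists sigma : {linear B -> tensor B B},
    (forall x, tens_mult (sigma x) = x) /\
    (forall a x c, sigma (a * x * c) = tens_bimul a c (sigma x)).

End Separable.

Arguments separable_algebra {k} B.

Record bimodule (k : fieldType) (S T : falgType k) := Bimodule {
  bimod_vect :> vectType k;
  lact : S -> bimod_vect -> bimod_vect;
  ract : bimod_vect -> T -> bimod_vect;
  lact_linearl : forall m, linear (lact^~ m);
  lact_linearr : forall s, linear (lact s);
  ract_linearl : forall t, linear (ract^~ t);
  ract_linearr : forall m, linear (ract m);
  lact1 : forall m, lact 1 m = m;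
  lactM : forall s s' m, lact (s * s') m = lact s (lact s' m);
  ract1 : forall m, ract m 1 = m;
  ractM : forall t t' m, ract m (t * t') = ract (ract m t) t';
  lractA : forall s m t, ract (lact s m) t = lact s (ract m t)
}.

(* (s, m, t) stands for the matrix with rows (s, m) and (0, t). *)
Definition trimx (k : fieldType) (S T : falgType k) (M : bimodule S T) : Type :=
  (S * M * T)%type.

Section TriangularMatrix.
Variables (k : fieldType) (S T : falgType k) (M : bimodule S T).

HB.instance Definition _ := Vector.on (trimx M).

Definition trimx_one : trimx M := (1, 0, 1).
Definition trimx_mul (x y : trimx M) : trimx M :=
  let: (s, m, t) := x in let: (s', m', t') := y in
  (s * s', lact s m' + ract m t', t * t').

Let lactDl s s' (m : M) : lact (s + s') m = lact s m + lact s' m.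
Proof. by have := lact_linearl m 1 s s'; rewrite !scale1r. Qed.
Let lactDr s (m m' : M) : lact s (m + m') = lact s m + lact s m'.
Proof. by have := lact_linearr s 1 m m'; rewrite !scale1r. Qed.
Let ractDl t (m m' : M) : ract (m + m') t = ract m t + ract m' t.
Proof. by have := ract_linearl t 1 m m'; rewrite !scale1r. Qed.
Let ractDr t t' (m : M) : ract m (t + t') = ract m t + ract m t'.
Proof. by have := ract_linearr m 1 t t'; rewrite !scale1r. Qed.
Let lactr0 s : lact s (0 : M) = 0.
Proof. by have := lact_linearr s (-1) 0 (0 : M); rewrite scaler0 addr0 scaleN1r addNr. Qed.
Let ractl0 t : ract (0 : M) t = 0.
Proof. by have := ract_linearl t (-1) 0 (0 : M); rewrite scaler0 addr0 scaleN1r addNr. Qed.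
Let lact0l (m : M) : lact 0 m = 0.
Proof. by have := lact_linearl m (-1) 0 0; rewrite scaler0 addr0 scaleN1r addNr. Qed.
Let ract0r (m : M) : ract m 0 = 0.
Proof. by have := ract_linearr m (-1) 0 0; rewrite scaler0 addr0 scaleN1r addNr. Qed.
Let lactZl a s (m : M) : lact (a *: s) m = a *: lact s m.
Proof. by have := lact_linearl m a s 0; rewrite !addr0 lact0l addr0. Qed.
Let lactZr a s (m : M) : lact s (a *: m) = a *: lact s m.
Proof. by have := lact_linearr s a m 0; rewrite !addr0 lactr0 addr0. Qed.
Let ractZl a t (m : M) : ract (a *: m) t = a *: ract m t.
Proof. by have := ract_linearl t a m 0; rewrite !addr0 ractl0 addr0. Qed.
Let ractZr a t (m : M) : ract m (a *: t) = a *: ract m t.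
Proof. by have := ract_linearr m a t 0; rewrite !addr0 ract0r addr0. Qed.

Fact trimx_mulA : associative trimx_mul.
Proof.
move=> [[s m] t] [[s' m'] t'] [[s'' m''] t''] /=.
by rewrite !mulrA lactM ractM lactDr ractDl lractA addrA.
Qed.
Fact trimx_mul1r : left_id trimx_one trimx_mul.
Proof. by move=> [[s m] t] /=; rewrite !mul1r lact1 ractl0 addr0. Qed.
Fact trimx_mulr1 : right_id trimx_one trimx_mul.
Proof. by move=> [[s m] t] /=; rewrite !mulr1 ract1 lactr0 add0r. Qed.
Fact trimx_mulDl : left_distributive trimx_mul +%R.
Proof.
move=> [[s m] t] [[s' m'] t'] [[s'' m''] t'']; rewrite /trimx_mul /=.
by congr (_, _, _); rewrite ?mulrDl // lactDl ractDl addrACA.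
Qed.
Fact trimx_mulDr : right_distributive trimx_mul +%R.
Proof.
move=> [[s m] t] [[s' m'] t'] [[s'' m''] t'']; rewrite /trimx_mul /=.
by congr (_, _, _); rewrite ?mulrDr // lactDr ractDr addrACA.
Qed.
Fact trimx_oner_neq0 : trimx_one != 0.
Proof. by apply/eqP => -[/eqP]; rewrite oner_eq0. Qed.

HB.instance Definition _ := GRing.Zmodule_isNzRing.Build (trimx M)
  trimx_mulA trimx_mul1r trimx_mulr1 trimx_mulDl trimx_mulDr trimx_oner_neq0.

Fact trimx_scalerAl a (x y : trimx M) : a *: (x * y) = (a *: x) * y.
Proof.
case: x y => [[s m] t] [[s' m'] t'].
by congr (_, _, _); rewrite /= ?scalerAl // scalerDr lactZl ractZl.
Qed.
HB.instance Definition _ := GRing.Lmodule_isLalgebra.Build k (trimx M)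
  trimx_scalerAl.

Fact trimx_scalerAr a (x y : trimx M) : a *: (x * y) = x * (a *: y).
Proof.
case: x y => [[s m] t] [[s' m'] t'].
by congr (_, _, _); rewrite /= ?scalerAr // scalerDr lactZr ractZr.
Qed.
HB.instance Definition _ := GRing.Lalgebra_isAlgebra.Build k (trimx M)
  trimx_scalerAr.
HB.instance Definition _ := Algebra_isFalgebra.Build k (trimx M).

End TriangularMatrix.

Section RadicalBimodule.
Variables (k : fieldType) (A : falgType k).
Hypothesis rad2 : (Jrad A ^+ 2)%VS = 0%VS.

Local Notation S := (aquot (Jrad A)).
Local Notation J := (subvs_of (Jrad A)).

Definition rad_lact (s : S) (m : J) : J :=
  Subvs (ideal_mull (arepr s) (subvsP m)).
Definition rad_ract (m : J) (s : S) : J :=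
  Subvs (ideal_mulr (arepr s) (subvsP m)).

Let rad2_mul x y : x \in Jrad_vs A -> y \in Jrad_vs A -> x * y = 0.
Proof.
move=> xJ yJ; apply/eqP; rewrite -memv0 -rad2.
exact: (memv_mul xJ yJ).
Qed.

Lemma rad_lactE a m : vsval (rad_lact (api (Jrad A) a) m) = a * vsval m.
Proof.
apply/eqP; rewrite -subr_eq0 -mulrBl; apply/eqP/rad2_mul; last exact: subvsP.
exact: api_repr.
Qed.
Lemma rad_ractE a m : vsval (rad_ract m (api (Jrad A) a)) = vsval m * a.
Proof.
apply/eqP; rewrite -subr_eq0 -mulrBr; apply/eqP/rad2_mul; first exact: subvsP.
exact: api_repr.
Qed.

Fact rad_lact_linearl m : linear (rad_lact^~ m).
Proof.
move=> a s s'; rewrite -[s]areprK -[s']areprK -linearP; apply: val_inj.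
rewrite [LHS]rad_lactE [RHS](linearP vsval).
by rewrite mulrDl -scalerAl; congr (_ *: _ + _); rewrite [RHS]rad_lactE.
Qed.
Fact rad_lact_linearr s : linear (rad_lact s).
Proof.
by move=> a m m'; apply: val_inj; rewrite /= mulrDr scalerAr.
Qed.
Fact rad_ract_linearl s : linear (rad_ract^~ s).
Proof.
by move=> a m m'; apply: val_inj; rewrite /= mulrDl scalerAl.
Qed.
Fact rad_ract_linearr m : linear (rad_ract m).
Proof.
move=> a s s'; rewrite -[s]areprK -[s']areprK -linearP; apply: val_inj.
rewrite [LHS]rad_ractE [RHS](linearP vsval).
by rewrite mulrDr -scalerAr; congr (_ *: _ + _); rewrite [RHS]rad_ractE.
Qed.
Fact rad_lact1 m : rad_lact 1 m = m.
Proof. by apply: val_inj; rewrite /= [LHS]rad_lactE mul1r. Qed.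
Fact rad_lactM s s' m : rad_lact (s * s') m = rad_lact s (rad_lact s' m).
Proof.
rewrite -[s]areprK -[s']areprK -apiM; apply: val_inj.
rewrite [LHS]rad_lactE -mulrA; apply/esym/(etrans (rad_lactE _ _)).
by congr (_ * _); apply: rad_lactE.
Qed.
Fact rad_ract1 m : rad_ract m 1 = m.
Proof. by apply: val_inj; rewrite /= [LHS]rad_ractE mulr1. Qed.
Fact rad_ractM s s' m : rad_ract m (s * s') = rad_ract (rad_ract m s) s'.
Proof.
rewrite -[s]areprK -[s']areprK -apiM; apply: val_inj.
rewrite [LHS]rad_ractE mulrA; apply/esym/(etrans (rad_ractE _ _)).
by congr (_ * _); apply: rad_ractE.
Qed.
Fact rad_lractA s m s' : rad_ract (rad_lact s m) s' = rad_lact s (rad_ract m s').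
Proof. by apply: val_inj; rewrite /= mulrA. Qed.

Definition rad_bimodule : bimodule S S :=
  @Bimodule k S S J rad_lact rad_ract rad_lact_linearl rad_lact_linearr
    rad_ract_linearl rad_ract_linearr rad_lact1 rad_lactM rad_ract1 rad_ractM
    rad_lractA.

Definition Sigma : falgType k := trimx rad_bimodule.

End RadicalBimodule.

HB.mixin Record hasLieBracket (k : fieldType) L of Vector k L := {
  lie : L -> L -> L;
  lie_linearl : forall y, linear (lie^~ y);
  lie_linearr : forall x, linear (lie x);
  liexx : forall x, lie x x = 0;
  lie_jacobi : forall x y z,
    lie x (lie y z) + lie y (lie z x) + lie z (lie x y) = 0
}.

#[short(type="finLieType")]
HB.structure Definition FinLie (k : fieldType) :=
  { L of hasLieBracket k L & Vector k L }.

Section LieTheory.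
Variables (k : fieldType) (L : finLieType k).

Definition rlie (y x : L) : L := lie x y.
HB.instance Definition _ (y : L) :=
  GRing.isSemilinear.Build k L L _ (rlie y)
    (GRing.semilinear_linear (lie_linearl y)).
HB.instance Definition _ (x : L) :=
  GRing.isSemilinear.Build k L L _ (lie x)
    (GRing.semilinear_linear (lie_linearr x)).

Lemma lieDl (y : L) : {morph lie^~ y : u v / u + v}.
Proof. exact: (raddfD (rlie y)). Qed.
Lemma lieDr (x : L) : {morph lie x : u v / u + v}.
Proof. exact: raddfD. Qed.
Lemma lieBl (y : L) : {morph lie^~ y : u v / u - v}.
Proof. exact: (raddfB (rlie y)). Qed.
Lemma lieBr (x : L) : {morph lie x : u v / u - v}.
Proof. exact: raddfB. Qed.
Lemma lieZl a (x y : L) : lie (a *: x) y = a *: lie x y.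
Proof. exact: (linearZ_LR (rlie y)). Qed.
Lemma lieZr a (x y : L) : lie x (a *: y) = a *: lie x y.
Proof. exact: linearZ_LR. Qed.
Lemma lie_suml (I : Type) r (P : pred I) (f : I -> L) y :
  lie (\sum_(i <- r | P i) f i) y = \sum_(i <- r | P i) lie (f i) y.
Proof. exact: (linear_sum (rlie y)). Qed.
Lemma lie_sumr (I : Type) r (P : pred I) (f : I -> L) x :
  lie x (\sum_(i <- r | P i) f i) = \sum_(i <- r | P i) lie x (f i).
Proof. exact: linear_sum. Qed.

Lemma lie_anti (x y : L) : lie x y = - lie y x.
Proof.
have := liexx (x + y); rewrite lieDr !lieDl !liexx add0r addr0 addrC => /eqP.
by rewrite addr_eq0 => /eqP.
Qed.

(* The span of the brackets [u, v] with u in U and v in V. *)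
Definition lie_comm (U V : {vspace L}) : {vspace L} :=
  <<[seq lie u v | u <- vbasis U, v <- vbasis V]>>%VS.

Lemma memv_lie (U V : {vspace L}) u v :
  u \in U -> v \in V -> lie u v \in lie_comm U V.
Proof.
move=> /coord_vbasis -> /coord_vbasis ->; rewrite lie_suml rpred_sum // => i _.
rewrite lie_sumr rpred_sum // => j _; rewrite lieZl lieZr !rpredZ // memv_span //.
by apply: allpairs_f; rewrite memt_nth.
Qed.

Lemma lie_commP (U V W : {vspace L}) :
  reflect {in U & V, forall u v, lie u v \in W} (lie_comm U V <= W)%VS.
Proof.
apply: (iffP idP) => [/subvP sW u v uU vV|h]; first exact/sW/memv_lie.
apply/span_subvP => _ /allpairsP [[u v] [/= uU vV ->]].
by apply: h; apply: vbasis_mem.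
Qed.

Fixpoint derived (U : {vspace L}) (n : nat) : {vspace L} :=
  if n is n'.+1 then lie_comm (derived U n') (derived U n') else U.

(* Solvability of U as a Lie algebra, when U is closed under the bracket. *)
Definition lie_solvable (U : {vspace L}) : Prop :=
  exists n, derived U n = 0%VS.

End LieTheory.

Record lieIdeal (k : fieldType) (L : finLieType k) := LieIdeal {
  lie_ideal_vs :> {vspace L};
  lie_ideal_mem : forall x y, y \in lie_ideal_vs -> lie x y \in lie_ideal_vs
}.

Definition lquot (k : fieldType) (L : finLieType k) (I : lieIdeal L) : Type :=
  vquot I.

Section LieQuotient.
Variables (k : fieldType) (L : finLieType k) (I : lieIdeal L).

HB.instance Definition _ := Vector.on (lquot I).

Definition lpi : {linear L -> lquot I} := @vpi k L I.
Definition lrepr : lquot I -> L := @vrepr k L I.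

Lemma lreprK : cancel lrepr lpi. Proof. exact: vreprK. Qed.

Definition lquot_lie (x y : lquot I) : lquot I := lpi (lie (lrepr x) (lrepr y)).

Lemma lpi_lie_def x y : lpi (lie x y) = lquot_lie (lpi x) (lpi y).
Proof.
apply/eqP; rewrite eq_sym; rewrite [_ == _]vpi_eq.
set x' := lrepr _; set y' := lrepr _.
have xI : x' - x \in (I : {vspace L}) by exact: vpi_repr.
have yI : y' - y \in (I : {vspace L}) by exact: vpi_repr.
have -> : lie x' y' - lie x y = lie x' (y' - y) - lie y (x' - x).
  rewrite !lieBr [lie y x']lie_anti [lie y x]lie_anti -opprD opprK.
  by rewrite addrA subrK.
by rewrite rpredB // lie_ideal_mem.
Qed.

Let lpi_lin a u v : a *: lpi u + lpi v = lpi (a *: u + v).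
Proof. by rewrite linearP. Qed.

Fact lquot_linearl y a x x' :
  lquot_lie (a *: x + x') y = a *: lquot_lie x y + lquot_lie x' y.
Proof.
rewrite -[x]lreprK -[x']lreprK -[y]lreprK lpi_lin -!lpi_lie_def.
by rewrite lie_linearl lpi_lin.
Qed.
Fact lquot_linearr x a y y' :
  lquot_lie x (a *: y + y') = a *: lquot_lie x y + lquot_lie x y'.
Proof.
rewrite -[x]lreprK -[y]lreprK -[y']lreprK lpi_lin -!lpi_lie_def.
by rewrite lie_linearr lpi_lin.
Qed.
Fact lquot_liexx x : lquot_lie x x = 0.
Proof. by rewrite -[x]lreprK -lpi_lie_def liexx linear0. Qed.
Fact lquot_jacobi x y z :
  lquot_lie x (lquot_lie y z) + lquot_lie y (lquot_lie z x) +
    lquot_lie z (lquot_lie x y) = 0.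
Proof.
rewrite -[x]lreprK -[y]lreprK -[z]lreprK -!lpi_lie_def -!linearD.
by rewrite lie_jacobi linear0.
Qed.
HB.instance Definition _ := hasLieBracket.Build k (lquot I)
  lquot_linearl lquot_linearr lquot_liexx lquot_jacobi.

Lemma lpi_lie x y : lpi (lie x y) = lie (lpi x) (lpi y).
Proof. exact: lpi_lie_def. Qed.
Lemma lpi_eq0 x : (lpi x == 0) = (x \in (I : {vspace L})).
Proof. exact: vpi_eq0. Qed.

End LieQuotient.

Definition lie_hom (k : fieldType) (L L' : finLieType k) (f : 'Hom(L, L')) :
  Prop := forall x y, f (lie x y) = lie (f x) (f y).

Section Derivations.
Variables (k : fieldType) (B : falgType k).
Implicit Types (b x y : B).

Definition in_Der_rad (d : 'End(B)) : Prop :=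
  (forall x y, d (x * y) = d x * y + x * d y) /\ (d @: Jrad B <= Jrad B)%VS.

Fact in_Der_rad_subspace : is_subspace in_Der_rad.
Proof.
split; first split=> [x y|].
- by rewrite !zero_lfunE mul0r mulr0 addr0.
- by apply/subvP => _ /memv_imgP [x _ ->]; rewrite zero_lfunE mem0v.
move=> a u v [Du /subvP ru] [Dv /subvP rv]; split=> [x y|].
  rewrite !add_lfunE !scale_lfunE Du Dv scalerDr mulrDl mulrDr.
  by rewrite -scalerAl -scalerAr addrACA.
apply/subvP => _ /memv_imgP [x xJ ->]; rewrite add_lfunE scale_lfunE.
by apply: rpredD; [apply/rpredZ/ru|apply: rv]; rewrite memv_img.
Qed.

Definition Der_rad_vs : {vspace 'End(B)} := subspace in_Der_rad_subspace.

Lemma Der_radP (d : 'End(B)) : d \in Der_rad_vs <-> in_Der_rad d.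
Proof. exact: subspaceP. Qed.

Definition Der_rad : Type := subvs_of Der_rad_vs.

HB.instance Definition _ := Vector.on Der_rad.

Let sum_aux (V : zmodType) (a b c e a' e' : V) :
  (a + b + (c + e)) - (a' + c + (b + e')) = (a - a') + (e - e').
Proof.
have -> : a + b + (c + e) = (b + c) + (a + e) by rewrite [a + b]addrC addrACA.
have -> : a' + c + (b + e') = (b + c) + (a' + e').
  by rewrite [a' + c]addrC addrACA [c + b]addrC.
by rewrite opprD addrACA subrr add0r opprD addrACA.
Qed.

Fact commutator_Der_rad (d d' : 'End(B)) :
  d \in Der_rad_vs -> d' \in Der_rad_vs ->
  ((d \o d') - (d' \o d))%VF \in Der_rad_vs.
Proof.
move=> /Der_radP [D1 /subvP r1] /Der_radP [D2 /subvP r2].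
apply/Der_radP; split=> [x y|].
  rewrite !add_lfunE !opp_lfunE !comp_lfunE D1 D2 !linearD /= !D1 !D2.
  by rewrite mulrBl mulrBr -opprD sum_aux.
apply/subvP => _ /memv_imgP [x xJ ->].
rewrite add_lfunE opp_lfunE !comp_lfunE.
by apply: rpredB; [apply/r1/memv_img/r2|apply/r2/memv_img/r1]; rewrite memv_img.
Qed.

Definition Der_rad_lie (d d' : Der_rad) : Der_rad :=
  Subvs (commutator_Der_rad (subvsP d) (subvsP d')).

Let Der_rad_lie_def d d' x :
  vsval (Der_rad_lie d d') x = vsval d (vsval d' x) - vsval d' (vsval d x).
Proof. by rewrite /= add_lfunE opp_lfunE !comp_lfunE. Qed.

Let jacobi_aux (V : zmodType) (a b c e f g : V) :
  (a - b) - (c - e) + ((c - f) - (g - b)) + ((g - e) - (a - f)) = 0.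
Proof.
rewrite !opprB (AC ((2*2)*(2*2)*(2*2))
  ((1*12)*(7*2)*(3*10)*(5*4)*(11*6)*(9*8))).
by rewrite /= !subrr !addr0.
Qed.

Fact Der_rad_linearl d' : linear (Der_rad_lie^~ d').
Proof.
move=> a d e; apply: val_inj => /=.
rewrite comp_lfunDl comp_lfunDr -comp_lfunZl -comp_lfunZr.
by rewrite scalerBr opprD addrACA.
Qed.
Fact Der_rad_linearr d : linear (Der_rad_lie d).
Proof.
move=> a d' e; apply: val_inj => /=.
rewrite comp_lfunDl comp_lfunDr -comp_lfunZl -comp_lfunZr.
by rewrite scalerBr opprD addrACA.
Qed.
Fact Der_rad_liexx d : Der_rad_lie d d = 0.
Proof. by apply: val_inj; rewrite /= subrr. Qed.
Fact Der_rad_jacobi d e f :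
  Der_rad_lie d (Der_rad_lie e f) + Der_rad_lie e (Der_rad_lie f d) +
    Der_rad_lie f (Der_rad_lie d e) = 0.
Proof.
have vD (u v : Der_rad) x : vsval (u + v) x = vsval u x + vsval v x.
  exact: add_lfunE.
have vB (u : Der_rad) y z : vsval u (y - z) = vsval u y - vsval u z.
  exact: linearB.
apply: val_inj; apply/lfunP => x; rewrite zero_lfunE.
rewrite !vD !Der_rad_lie_def !vB.
exact: jacobi_aux.
Qed.
HB.instance Definition _ := hasLieBracket.Build k Der_rad
  Der_rad_linearl Der_rad_linearr Der_rad_liexx Der_rad_jacobi.

Lemma Der_rad_lieE (d d' : Der_rad) x :
  vsval (lie d d') x = vsval d (vsval d' x) - vsval d' (vsval d x).
Proof. exact: Der_rad_lie_def. Qed.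

Definition in_Inn (d : Der_rad) : Prop :=
  exists b, forall x, vsval d x = b * x - x * b.

Fact in_Inn_subspace : is_subspace in_Inn.
Proof.
split; first by exists 0 => x; rewrite zero_lfunE mul0r mulr0 subrr.
move=> a d e [b Eb] [c Ec]; exists (a *: b + c) => x.
rewrite /= add_lfunE scale_lfunE Eb Ec mulrDl mulrDr -scalerAl -scalerAr.
by rewrite scalerBr opprD addrACA.
Qed.

Definition Inn_vs : {vspace Der_rad} := subspace in_Inn_subspace.

Lemma InnP d : d \in Inn_vs <-> in_Inn d.
Proof. exact: subspaceP. Qed.

(* [b, -] = amull b - amulr b always lies in Der_rad B, so that in_Inn misses
   no inner derivation of B. *)
Lemma ad_Der_rad b : (amull b - amulr b)%VF \in Der_rad_vs.
Proof.
apply/Der_radP; split=> [x y|].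
  rewrite !add_lfunE !opp_lfunE !lfunE /=.
  by rewrite mulrBl mulrBr !mulrA addrA subrK.
apply/subvP => _ /memv_imgP [x xJ ->].
rewrite !add_lfunE !opp_lfunE !lfunE /=.
by rewrite rpredB //; [apply: rad_mull|apply: rad_mulr].
Qed.

Fact Inn_ideal d d' : d' \in Inn_vs -> lie d d' \in Inn_vs.
Proof.
move=> /InnP [b Eb]; apply/InnP; exists (vsval d b) => x.
have /Der_radP [D _] := subvsP d.
have dB y z : vsval d (y - z) = vsval d y - vsval d z by exact: linearB.
rewrite Der_rad_lieE !Eb dB !D opprD opprB.
rewrite (AC ((2*2)*2) ((1*4)*(5*3)*(2*6))) /=.
by rewrite !subrr !addr0.
Qed.

Definition Inn : lieIdeal Der_rad := LieIdeal Inn_ideal.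

Definition HH1rad : finLieType k := lquot Inn.

End Derivations.

Arguments HH1rad {k} B.

(* Main.v *)
Require Import Defs.
From HB Require Import structures.
From mathcomp Require Import all_boot all_algebra falgebra.

Import GRing.Theory.
Local Open Scope ring_scope.

Set Implicit Arguments.
Unset Strict Implicit.
Unset Printing Implicit Defensive.

(** Write J for the radical of A and S for A / J.  A derivation d of A that
preserves J induces a derivation dbar of S and restricts to J, and
    (s, m, t) |-> (dbar s, d m, dbar t)
is a derivation of Sigma ([ind_der]).  This assignment respects brackets and
sends [b, -] to the bracket with (b, 0, b) mod J, so it induces a homomorphism
phi of Lie algebras from HH1rad A to HH1rad Sigma ([ind_HH1rad]).

Separability of S enters only through a Casimir element: finitely many pairs
(x_i, y_i) of elements of A with sum_i x_i y_i = 1 mod J and such that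
sum_i F (a x_i, y_i) = sum_i F (x_i, y_i a) for every bilinear F that only
depends on its arguments mod J ([separable_casimir]).  Averaging over it shows
that derivations are inner in the situations that matter
([derivation_inner], [diag_inner]), and it turns a linear projection of A onto
J into a derivation p with values in J that is the identity on J
([der_rad_proj]); the kernel of p is then a subalgebra complementing J.

Surjectivity ([ind_der_surj]).  Up to an inner derivation, a derivation of Sigma
vanishes on the diagonal, hence it maps the corner to itself by a map f of
S-bimodules on J.  The derivation f o p of A induces it.

Kernel ([ind_der_ker_comm]).  If the derivation induced by d is inner, then up
to an inner derivation d maps A to J and acts on J as right multiplication by
an element z central mod J.  The bracket of two such derivations maps A to J
and vanishes on J, because z z' - z' z lies in J and J^2 = 0; by averaging it is
inner.  So the kernel of phi is even abelian.

The last assertion of the theorem is the fact that solvability passes to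
homomorphic images and to extensions ([lie_solvable_ext]). *)

(** * Solvability under extensions *)

Section Solvable.
Variables (k : fieldType).

Lemma derivedS (L : finLieType k) (U V : {vspace L}) n :
  (U <= V)%VS -> (derived U n <= derived V n)%VS.
Proof.
move=> sUV; elim: n => [|n /subvP IH] //=.
by apply/lie_commP => u v uU vU; apply: memv_lie; apply: IH.
Qed.

Lemma derivedD (L : finLieType k) (U : {vspace L}) m n :
  derived U (m + n) = derived (derived U n) m.
Proof. by elim: m => //= m ->. Qed.

Variables (L L' : finLieType k) (f : 'Hom(L, L')).
Hypothesis fL : lie_hom f.

Lemma limg_lie_comm (U V : {vspace L}) :
  (f @: lie_comm U V)%VS = lie_comm (f @: U) (f @: V).
Proof.
apply: subv_anti; apply/andP; split.
  rewrite limg_span; apply/span_subvP => _ /mapP [w Uw ->].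
  have /allpairsP [[u v] [/= uU vV ->]] := Uw.
  by rewrite fL memv_lie ?memv_img ?vbasis_mem.
apply/lie_commP => _ _ /memv_imgP [u uU ->] /memv_imgP [v vV ->].
by rewrite -fL memv_img ?memv_lie.
Qed.

Lemma limg_derived (U : {vspace L}) n :
  (f @: derived U n)%VS = derived (f @: U) n.
Proof. by elim: n => //= n <-; rewrite limg_lie_comm. Qed.

(** The total Lie algebra of a surjective homomorphism with solvable kernel is
solvable exactly when its image is. *)
Lemma lie_solvable_ext : limg f = fullv -> lie_solvable (lker f) ->
  (lie_solvable (fullv : {vspace L'}) <-> lie_solvable (fullv : {vspace L})).
Proof.
move=> fsurj [m km]; split=> [] [n dn].
  exists (m + n)%N; apply/eqP; rewrite -subv0 derivedD -km.
  by apply: derivedS; rewrite lkerE limg_derived fsurj dn.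
by exists n; rewrite -fsurj -limg_derived dn limg0.
Qed.

End Solvable.

(** * Casimir elements *)

Section Casimir.
Variables (k : fieldType).

Lemma lfun_of_linear (U V : vectType k) (f : U -> V) :
  linear f -> exists g : 'Hom(U, V), g =1 f.
Proof.
move=> f_lin; pose F := GRing.isSemilinear.Build k U V _ f
  (GRing.semilinear_linear f_lin).
exists (linfun (HB.pack f F : {linear U -> V})).
by move=> u; rewrite lfunE.
Qed.

(** Bilinear maps of vector spaces. *)
Definition bilin (U V W : vectType k) (F : U -> V -> W) : Prop :=
  (forall v, linear (F^~ v)) /\ (forall u, linear (F u)).

(** The family of pairs (x_i, y_i) represents a separability idempotent of
A / J: sum_i x_i y_i is 1 mod J, and sum_i x_i (x) y_i, read in A / J (x) A / J,
commutes with the action of A.  The tensor product is replaced by its universal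
property: bilinear maps on A / J are bilinear maps on A that vanish as soon as
one argument is in J. *)
Definition casimir_mod (A : falgType k) (J : {vspace A})
    (I : finType) (x y : I -> A) : Prop :=
  1 - \sum_i x i * y i \in J /\
  forall (W : vectType k) (F : A -> A -> W), bilin F ->
    (forall u v, u \in J -> F u v = 0) -> (forall u v, v \in J -> F u v = 0) ->
  forall a, \sum_i F (a * x i) (y i) = \sum_i F (x i) (y i * a).

(** The pairs are the terms of sigma 1, expanded in a basis of A / J and lifted
to A; both sides of the exchange property are images of sigma a. *)
Lemma separable_casimir (A : falgType k) (J : algIdeal A) :
  separable_algebra (aquot J) ->
  exists (I : finType) (x y : I -> A), casimir_mod J x y.
Proof.
case=> sigma [mult_sigma sigma_bimod].
pose e := vbasis {: aquot J}; pose t := sigma 1.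
pose E (i : 'I_(\dim {: aquot J})) := arepr (I := J) e`_i.
exists ('I_(\dim {: aquot J}) * 'I_(\dim {: aquot J}))%type.
exists (fun ij => t ij.1 ij.2 *: E ij.1), (fun ij => E ij.2).
split=> [|W F [Fl Fr] FJl FJr a].
  rewrite -api_eq0 linearB /= api1 subr_eq0 -[1 in eqbLHS]mult_sigma.
  rewrite /tens_mult /tens_lift pair_big linear_sum /=; apply/eqP.
  apply: eq_bigr => ij _.
  by rewrite -scalerAl (linearZ_LR (api J)) /= apiM !areprK.
have F0l v : F 0 v = 0 by apply: FJl; apply: mem0v.
have Fmod u u' v v' : u - u' \in (J : {vspace A}) ->
    v - v' \in (J : {vspace A}) -> F u v = F u' v'.
  move=> uJ vJ; rewrite -[u](subrK u') -[v](subrK v').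
  have := Fl (v - v' + v') 1 (u - u') u'; rewrite !scale1r => ->.
  rewrite FJl // add0r.
  by have := Fr u' 1 (v - v') v'; rewrite !scale1r => ->; rewrite FJr // add0r.
have FZl c u v : F (c *: u) v = c *: F u v.
  by have := Fl v c u 0; rewrite !addr0 F0l addr0.
pose G s s' := F (arepr (I := J) s) (arepr (I := J) s').
have Glin : (forall s', linear (G^~ s')) /\ (forall s, linear (G s)).
  split=> s c u v; rewrite /G -?Fl -?Fr; apply: Fmod; rewrite ?subrr ?mem0v //.
  - by rewrite -api_eq linearP /= !areprK.
  - by rewrite -api_eq linearP /= !areprK.
have lift_bimul (b c : aquot J) :
    tens_lift G (tens_bimul b c t) =
    \sum_ij t ij.1 ij.2 *: G (b * e`_ij.1) (e`_ij.2 * c).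
  rewrite /tens_bimul [X in tens_lift G X]/tens_lift linear_sum.
  rewrite -(pair_bigA _ (fun i j => t i j *: G (b * e`_i) (e`_j * c))) /=.
  apply: eq_bigr => i _; rewrite linear_sum; apply: eq_bigr => j _.
  by rewrite linearZ /= tens_liftE; [| case: Glin..].
have := congr1 (tens_lift G) (sigma_bimod 1 1 (api J a)).
rewrite !mul1r -[X in sigma X]mulr1 -[X in sigma X]mulr1 sigma_bimod -/t.
rewrite !lift_bimul => eq_sum.
(* The sums over the lifts agree with those over the basis of A / J. *)
transitivity (\sum_ij t ij.1 ij.2 *: G (api J a * e`_ij.1) (e`_ij.2 * 1)).
  apply: eq_bigr => ij _; rewrite -scalerAr FZl; congr (_ *: _).
  apply: Fmod; first by rewrite -api_eq apiM !areprK.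
  by rewrite mulr1 subrr mem0v.
rewrite eq_sum; apply: eq_bigr => ij _; rewrite FZl; congr (_ *: _).
apply: Fmod; first by rewrite mul1r subrr mem0v.
by rewrite -api_eq apiM !areprK.
Qed.

End Casimir.

(** * Derivations of a square-zero extension *)

Section Averaging.
Variables (k : fieldType) (A : falgType k) (J : {vspace A}).
Variables (I : finType) (x y : I -> A).
Hypothesis xy : casimir_mod J x y.

(** If d, read modulo the left ideal K, is a derivation from A / J to an
A / J-bimodule, then it is the inner derivation of sum_i d(x_i) y_i modulo K. *)
Lemma derivation_inner (K : {vspace A}) (d : {linear A -> A}) :
  (forall a u, u \in K -> a * u \in K) ->
  (forall a b, d (a * b) = d a * b + a * d b) ->
  (forall a b, a \in J -> d a * b \in K) ->
  (forall a b, b \in J -> d a * b \in K) ->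
  forall a,
    d a - ((\sum_i d (x i) * y i) * a - a * (\sum_i d (x i) * y i)) \in K.
Proof.
move=> Kl dM dJl dJr a; set b := \sum_i _; have [sum1 avg] := xy.
have e : \sum_i vpi K (d (a * x i) * y i) =
    \sum_i vpi K (d (x i) * (y i * a)).
  apply: (avg (vquot K) (fun u v => vpi K (d u * v))) => [|u v uJ|u v vJ].
  - split=> [v|u] c u1 u2; first by rewrite -linearP scalerAl -mulrDl -linearP.
    by rewrite -linearP scalerAr -mulrDr.
  - by apply/eqP; rewrite vpi_eq0 dJl.
  - by apply/eqP; rewrite vpi_eq0 dJr.
have {e} : \sum_i d (a * x i) * y i - b * a \in K.
  rewrite -vpi_eq0 linearB subr_eq0 linear_sum /= e /b mulr_suml linear_sum /=.
  by apply/eqP/eq_bigr => i _; rewrite mulrA.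
have -> : \sum_i d (a * x i) * y i = d a * (\sum_i x i * y i) + a * b.
  rewrite /b !mulr_sumr -big_split /=; apply: eq_bigr => i _.
  by rewrite dM mulrDl !mulrA.
move=> h; rewrite -[d a]mulr1 -[in d a * _](subrK (\sum_i x i * y i) 1) mulrDr.
by rewrite opprB -addrA rpredD ?dJr // addrA.
Qed.

End Averaging.

Section SquareZero.
Variables (k : fieldType) (A : falgType k).
Local Notation J := (Jrad A).
Hypothesis rad2 : (J ^+ 2)%VS = 0%VS.
Variables (I : finType) (x y : I -> A).
Hypothesis xy : casimir_mod J x y.

Lemma rad_mul0 a b :
  a \in (J : {vspace A}) -> b \in (J : {vspace A}) -> a * b = 0.
Proof. by move=> aJ bJ; apply/eqP; rewrite -memv0 -rad2 (memv_mul aJ bJ). Qed.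

Lemma der_radM (d : Der_rad A) a b :
  vsval d (a * b) = vsval d a * b + a * vsval d b.
Proof. by case/Der_radP: (subvsP d). Qed.

Lemma der_rad_mem (d : Der_rad A) a :
  a \in (J : {vspace A}) -> vsval d a \in (J : {vspace A}).
Proof.
by case/Der_radP: (subvsP d) => _ /subvP dJ /(memv_img (vsval d))/dJ.
Qed.

(** The derivation of A / J induced by d is inner. *)
Lemma der_inner_mod (d : Der_rad A) :
  exists b, forall a, vsval d a - (b * a - a * b) \in (J : {vspace A}).
Proof.
exists (\sum_i vsval d (x i) * y i); apply: (derivation_inner xy).
- exact: ideal_mull.
- exact: der_radM.
- by move=> a b /(der_rad_mem d); apply: ideal_mulr.
- by move=> a b; apply: ideal_mull.
Qed.

(** Such a d is a derivation from A / J to the bimodule J. *)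
Lemma der_rad_inner (d : Der_rad A) :
  (forall a, vsval d a \in (J : {vspace A})) ->
  (forall a, a \in (J : {vspace A}) -> vsval d a = 0) ->
  d \in Inn_vs A.
Proof.
move=> dA dJ; apply/InnP; exists (\sum_i vsval d (x i) * y i) => a.
apply/eqP; rewrite -subr_eq0 -memv0; apply: (derivation_inner xy).
- by move=> {}a u; rewrite !memv0 => /eqP->; rewrite mulr0.
- exact: der_radM.
- by move=> {}a b /dJ e; rewrite [_ a]e mul0r mem0v.
- by move=> {}a b bJ; rewrite rad_mul0 ?mem0v //; apply: dA.
Qed.

(** A form of the Wedderburn principal theorem: A is the direct sum of J and the
subalgebra on which p vanishes. *)
Lemma der_rad_proj : exists p : Der_rad A,
  (forall a, vsval p a \in (J : {vspace A})) /\
  (forall a, a \in (J : {vspace A}) -> vsval p a = a).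
Proof.
have [sum1 avg] := xy.
(* For fixed a, F a u v measures how far q is from being A-linear; it only
   depends on u and v mod J, since q is the identity on J and J^2 = 0. *)
pose q := projv J; pose F a u v := (q (a * u) - a * q u) * v.
have qJ a : q a \in (J : {vspace A}) by apply: memv_proj.
have FJ a u : q (a * u) - a * q u \in (J : {vspace A}).
  by rewrite rpredB // ideal_mull.
pose p a := \sum_i F a (x i) (y i).
have plin : linear p.
  move=> c a b; rewrite /p scaler_sumr -big_split; apply: eq_bigr => i _ /=.
  rewrite /F ![(c *: a + b) * _]mulrDl linearD -!scalerAl linearZ /=.
  rewrite opprD addrACA.
  by rewrite -scalerN -scalerDr mulrDl scalerAl.
have [P PE] := lfun_of_linear plin.
have pJ a : p a \in (J : {vspace A}).
  by apply: rpred_sum => i _; apply/ideal_mulr/FJ.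
have pid a : a \in (J : {vspace A}) -> p a = a.
  move=> aJ; rewrite /p /F.
  under eq_bigr => i _.
    rewrite (rad_mul0 aJ (qJ _)) subr0 projv_id ?ideal_mulr // -mulrA; over.
  rewrite -mulr_sumr -[RHS]mulr1 -[in RHS](subrK (\sum_i x i * y i) 1).
  by rewrite mulrDr (rad_mul0 aJ sum1) add0r.
have pM a b : p (a * b) = p a * b + a * p b.
  have e : \sum_i F a (b * x i) (y i) = \sum_i F a (x i) (y i * b).
    apply: avg => [|u v uJ|u v vJ]; last exact: rad_mul0 (FJ _ _) vJ.
      split=> [v c u u'|u c v v']; rewrite /F; last by rewrite mulrDr scalerAr.
      rewrite mulrDr -scalerAr !linearP mulrDr -scalerAr opprD addrACA.
      by rewrite -scalerBr mulrDl scalerAl.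
    by rewrite /F !projv_id ?ideal_mull // subrr mul0r.
  rewrite {2}/p mulr_suml.
  under [X in _ = X + _]eq_bigr do rewrite /F -mulrA -/(F _ _ _).
  rewrite -e /p mulr_sumr -big_split; apply: eq_bigr => i _ /=.
  rewrite /F [a * (_ * y i)]mulrA -mulrDl; congr (_ * _).
  by rewrite mulrBr !mulrA addrA subrK.
have pD : P \in Der_rad_vs A.
  apply/Der_radP; split=> [a b|]; first by rewrite !PE pM.
  by apply/subvP => _ /memv_imgP [a aJ ->]; rewrite PE.
by exists (Subvs pD); split=> a; rewrite /= PE; auto.
Qed.

End SquareZero.

(** * Derivations induced on the triangular algebra *)

(** An element generating a right ideal of square zero lies in the radical: a
maximal right ideal missing n would contain 1 - n c for some c, whose inverse is
1 + n c. *)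
Lemma square_zero_in_Jrad (k : fieldType) (B : falgType k) (n : B) :
  (forall a, n * a * n = 0) -> n \in Jrad_vs B.
Proof.
move=> n0; apply/Jrad_vsP => M [rM Mfull Mmax].
have [//|nM] := boolP (n \in M); case: Mfull; apply/vspaceP => a; rewrite memvf.
have sMN : (M <= M + amull n @: fullv)%VS by apply: addvSl.
have [] := Mmax (M + amull n @: fullv)%VS _ sMN.
- move=> u b /memv_addP [m mM [_ /memv_imgP [c _ ->] ->]].
  rewrite lfunE mulrDl /= -mulrA memv_add ?rM //.
  by apply/memv_imgP; exists (c * b); rewrite ?memvf // lfunE.
- move=> e; case/negP: nM; rewrite -e (subvP (addvSr _ _)) //.
  by apply/memv_imgP; exists 1; rewrite ?memvf // lfunE /= mulr1.
move=> e; have : 1 \in (M + amull n @: fullv)%VS by rewrite e memvf.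
move=> /memv_addP [m mM [_ /memv_imgP [c _ ->]]]; rewrite lfunE /= => e1.
have -> : a = m * (1 + n * c) * a.
  have -> : m = 1 - n * c by rewrite e1 addrK.
  by rewrite mulrDr mulr1 mulrBl mul1r mulrA n0 mul0r subr0 subrK mul1r.
by rewrite -mulrA rM.
Qed.

Section Induced.
Variables (k : fieldType) (A : falgType k).
Local Notation J := (Jrad A).
Local Notation S := (aquot J).
Hypothesis rad2 : (J ^+ 2)%VS = 0%VS.
Local Notation Sig := (Sigma rad2).

(** The matrix with rows (s, m) and (0, t), as an element of Sigma. *)
Definition tri (s : S) (m : subvs_of J) (t : S) : Sig := (s, m, t).

Lemma triE (z : Sig) : z = tri z.1.1 z.1.2 z.2.
Proof. by case: z => [[]]. Qed.
Lemma tri_inj s m t s' m' t' :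
  tri s m t = tri s' m' t' -> [/\ s = s', m = m' & t = t'].
Proof. by case. Qed.
Lemma triP c s m t s' m' t' :
  c *: tri s m t + tri s' m' t' = tri (c *: s + s') (c *: m + m') (c *: t + t').
Proof. by []. Qed.
Lemma triD s m t s' m' t' :
  tri s m t + tri s' m' t' = tri (s + s') (m + m') (t + t').
Proof. by []. Qed.
Lemma triB s m t s' m' t' :
  tri s m t - tri s' m' t' = tri (s - s') (m - m') (t - t').
Proof. by []. Qed.
Lemma triM s m t s' m' t' :
  tri s m t * tri s' m' t' =
  tri (s * s') (rad_lact s m' + rad_ract m t') (t * t').
Proof. by []. Qed.

Lemma subvsD (m m' : subvs_of J) : vsval (m + m') = vsval m + vsval m'.
Proof. by []. Qed.
Lemma subvsB (m m' : subvs_of J) : vsval (m - m') = vsval m - vsval m'.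
Proof. by []. Qed.
Lemma vsval_lact a m : vsval (rad_lact (api J a) m) = a * vsval m.
Proof. exact: rad_lactE. Qed.
Lemma vsval_ract a m : vsval (rad_ract m (api J a)) = vsval m * a.
Proof. exact: rad_ractE. Qed.
Definition act_vsvalE := (vsval_lact, vsval_ract, subvsB, subvsD).

Lemma rad_lact0 s : rad_lact s (0 : subvs_of J) = 0.
Proof. by apply: val_inj; rewrite /= mulr0. Qed.
Lemma rad_ract0 s : rad_ract (0 : subvs_of J) s = 0.
Proof. by apply: val_inj; rewrite /= mul0r. Qed.
Lemma rad_0act m : rad_lact (0 : S) m = 0.
Proof.
rewrite -{1}(linear0 (api J)); apply: val_inj.
by rewrite [LHS]rad_lactE // mul0r.
Qed.
Lemma rad_act0 m : rad_ract m (0 : S) = 0.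
Proof.
rewrite -{1}(linear0 (api J)); apply: val_inj.
by rewrite [LHS]rad_ractE // mulr0.
Qed.

Lemma tri_comm a b c m e :
  tri (api J a) 0 (api J b) * tri (api J c) m (api J e) -
    tri (api J c) m (api J e) * tri (api J a) 0 (api J b) =
  tri (api J (a * c - c * a)) (rad_lact (api J a) m - rad_ract m (api J b))
      (api J (b * e - e * b)).
Proof.
rewrite !triM triB rad_lact0 rad_ract0 addr0 add0r -!apiM.
by rewrite -!(linearB (api J)).
Qed.

Lemma tri_apiP (z : Sig) : exists a m b, z = tri (api J a) m (api J b).
Proof. by exists (arepr z.1.1), z.1.2, (arepr z.2); rewrite !areprK -triE. Qed.

Lemma corner_Jrad m : tri 0 m 0 \in Jrad_vs Sig.
Proof.
apply: square_zero_in_Jrad => z; rewrite (triE z) !triM !mul0r.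
by rewrite !rad_0act rad_act0 !addr0.
Qed.

Implicit Types (d : Der_rad A).

(** The map (s, m, t) |-> (dbar s, d m, dbar t) on Sigma.  It is well defined on
representatives because d preserves the radical. *)
Definition ind_fun d (z : Sig) : Sig :=
  tri (api J (vsval d (arepr z.1.1))) (vsproj J (vsval d (vsval z.1.2)))
      (api J (vsval d (arepr z.2))).

Lemma ind_fun_tri d a (m : subvs_of J) b :
  ind_fun d (tri (api J a) m (api J b)) =
  tri (api J (vsval d a)) (vsproj J (vsval d (vsval m))) (api J (vsval d b)).
Proof.
have dJ c : api J (vsval d (arepr (api J c))) = api J (vsval d c).
  by apply/eqP; rewrite api_eq -linearB der_rad_mem ?api_repr.
by rewrite /ind_fun /= !dJ.
Qed.

Lemma ind_fun_linear d : linear (ind_fun d).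
Proof.
move=> c z z'; have [a [m [b ->]]] := tri_apiP z.
have [a' [m' [b' ->]]] := tri_apiP z'.
by rewrite triP -!linearP !ind_fun_tri triP -!linearP /= !linearP.
Qed.
HB.instance Definition _ d :=
  GRing.isSemilinear.Build k Sig Sig _ (ind_fun d)
    (GRing.semilinear_linear (ind_fun_linear d)).

Definition ind_end d : 'End(Sig) := linfun (ind_fun d).

Lemma ind_endE d a (m : subvs_of J) b :
  ind_end d (tri (api J a) m (api J b)) =
  tri (api J (vsval d a)) (vsproj J (vsval d (vsval m))) (api J (vsval d b)).
Proof. by rewrite lfunE /= ind_fun_tri. Qed.

Lemma vsproj_der d (m : subvs_of J) :
  vsval (vsproj J (vsval d (vsval m))) = vsval d (vsval m).
Proof. by rewrite vsprojK ?der_rad_mem ?subvsP. Qed.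

Lemma ind_endM d z z' :
  ind_end d (z * z') = ind_end d z * z' + z * ind_end d z'.
Proof.
have [a [m [b ->]]] := tri_apiP z.
have [a' [m' [b' ->]]] := tri_apiP z'.
rewrite triM -!apiM !ind_endE !triM -!apiM triD -!linearD -!der_radM.
congr tri; apply: subvs_inj.
rewrite vsproj_der !act_vsvalE !vsproj_der linearD /=.
by rewrite !der_radM addrACA.
Qed.

Variables (I : finType) (x y : I -> A).
Hypothesis xy : casimir_mod J x y.

(** Up to the inner derivation given by [der_inner_mod], the induced derivation
maps Sigma to the corner, which is contained in the radical. *)
Lemma ind_end_Der_rad d : ind_end d \in Der_rad_vs Sig.
Proof.
apply/Der_radP; split; first exact: ind_endM.
have [b db] := der_inner_mod xy d.
apply/subvP => _ /memv_imgP [z zJ ->].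
pose w : Sig := tri (api J b) 0 (api J b).
rewrite -[ind_end d z](subrK (w * z - z * w)).
rewrite rpredD //; last by apply: rpredB; [apply: rad_mull|apply: rad_mulr].
have [a [m [a' ->]]] := tri_apiP z.
have {}db c : api J (vsval d c) - api J (b * c - c * b) = 0.
  by rewrite -linearB; apply/eqP; rewrite api_eq0.
rewrite ind_endE tri_comm triB !db.
exact: corner_Jrad.
Qed.

(** The derivation of Sigma induced by d, as an element of Der_rad. *)
Definition ind_der d : Der_rad Sig := Subvs (ind_end_Der_rad d).

Lemma ind_derE d a (m : subvs_of J) b :
  vsval (ind_der d) (tri (api J a) m (api J b)) =
  tri (api J (vsval d a)) (vsproj J (vsval d (vsval m))) (api J (vsval d b)).
Proof. exact: ind_endE. Qed.

Lemma der_rad_ext (B : falgType k) (d e : Der_rad B) :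
  (forall z, vsval d z = vsval e z) -> d = e.
Proof. by move=> de; apply/val_inj/lfunP. Qed.

Lemma ind_der_linear : linear ind_der.
Proof.
move=> c d e; apply: der_rad_ext => z; have [a [m [b ->]]] := tri_apiP z.
rewrite [RHS]add_lfunE [X in _ = X + _]scale_lfunE !ind_derE triP -!linearP.
by rewrite !add_lfunE !scale_lfunE.
Qed.

Lemma ind_der_lie d e : ind_der (lie d e) = lie (ind_der d) (ind_der e).
Proof.
apply: der_rad_ext => z; have [a [m [b ->]]] := tri_apiP z.
by rewrite Der_rad_lieE !ind_derE triB !Der_rad_lieE !vsproj_der -!linearB.
Qed.

Lemma ind_der_Inn d : d \in Inn_vs A -> ind_der d \in Inn_vs Sig.
Proof.
move=> /InnP [b db]; apply/InnP; exists (tri (api J b) 0 (api J b)) => z.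
have [a [m [a' ->]]] := tri_apiP z.
rewrite ind_derE tri_comm -!db; congr tri; apply: subvs_inj.
by rewrite vsproj_der db !act_vsvalE.
Qed.

End Induced.

(** * Image and kernel of the induced map *)

Section ImageKernel.
Variables (k : fieldType) (A : falgType k).
Local Notation J := (Jrad A).
Hypothesis rad2 : (J ^+ 2)%VS = 0%VS.
Local Notation Sig := (Sigma rad2).
Variables (I : finType) (x y : I -> A).
Hypothesis xy : casimir_mod J x y.
Local Notation tri := (tri rad2).
Local Notation diag a b := (tri (api J a) 0 (api J b)).

(** The diagonal of Sigma is A / J x A / J, whose separability idempotent is the
sum of those of the two factors. *)
Lemma diag_inner (D : Der_rad Sig) : exists w,
  forall a b, vsval D (diag a b) = w * diag a b - diag a b * w.
Proof.
have [sum1 avg] := xy.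
(* The two embeddings of A / J in the diagonal, indexed by a boolean. *)
pose g (e : bool) (a : A) : Sig := if e then diag a 0 else diag 0 a.
have gP e c a b : g e (c *: a + b) = c *: g e a + g e b.
  by case: e; rewrite /g triP -!linearP !scaler0 !addr0.
have gM e a b : g e a * g e b = g e (a * b).
  by case: e; rewrite /g triM -!apiM rad_lact0 rad_ract0 !addr0 mul0r.
have gJ e a : a \in (J : {vspace A}) -> g e a = 0.
  by rewrite -api_eq0 /g => /eqP->; case: e; rewrite linear0.
have g0 e : g e 0 = 0 by rewrite gJ ?mem0v.
have gD e a b : g e (a + b) = g e a + g e b.
  by rewrite -[a]scale1r gP !scale1r.
have gsum e : \sum_i g e (x i * y i) = g e 1.
  rewrite -[in RHS](subrK (\sum_i x i * y i) 1) gD gJ // add0r.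
  by apply/esym/big_morph => // u v; rewrite gD.
have g1 : g true 1 + g false 1 = 1.
  by rewrite /g triD !(linear0 (api J)) !addr0 add0r api1.
pose w e := \sum_i vsval D (g e (x i)) * g e (y i).
exists (w true + w false) => a b; set c := diag a b.
have gl e u : c * g e u = g e ((if e then a else b) * u).
  by case: e; rewrite /g /c triM -!apiM rad_lact0 rad_ract0 addr0 mulr0.
have gr e u : g e u * c = g e (u * (if e then a else b)).
  by case: e; rewrite /g /c triM -!apiM rad_lact0 rad_ract0 addr0 mul0r.
have wc e : w e * c = vsval D c * g e 1 + c * w e.
  have -> : w e * c = \sum_i vsval D (c * g e (x i)) * g e (y i).
    rewrite mulr_suml; under eq_bigr do rewrite -mulrA gr.
    under [RHS]eq_bigr do rewrite gl.
    apply/esym/(avg Sig (fun u v => vsval D (g e u) * g e v)).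
    - split=> [v|u] t u1 u2; first by rewrite gP linearP mulrDl scalerAl.
      by rewrite gP mulrDr scalerAr.
    - by move=> u v uJ; rewrite (gJ _ _ uJ) linear0 mul0r.
    - by move=> u v vJ; rewrite (gJ _ _ vJ) mulr0.
  rewrite -gsum !mulr_sumr -big_split; apply: eq_bigr => i _ /=.
  by rewrite der_radM mulrDl -gM !mulrA.
rewrite mulrDl !wc addrACA -!mulrDr g1 mulr1.
by rewrite addrK.
Qed.

(** Every derivation of Sigma is, up to an inner one, induced from A. *)
Lemma ind_der_surj (D : Der_rad Sig) :
  exists d : Der_rad A, D - ind_der rad2 xy d \in Inn_vs Sig.
Proof.
have [w Dw] := diag_inner D.
have [p [pA pJ]] := der_rad_proj rad2 xy.
pose F : 'End(Sig) := (vsval D - (amull w - amulr w))%VF.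
have FE z : F z = vsval D z - (w * z - z * w).
  by rewrite /F !add_lfunE !opp_lfunE add_lfunE opp_lfunE !lfunE.
have FM z z' : F (z * z') = F z * z' + z * F z'.
  rewrite !FE der_radM [in RHS]mulrBl [in RHS]mulrBr addrACA -opprD.
  by rewrite mulrBl mulrBr !mulrA addrA subrK.
have Fd a b : F (diag a b) = 0 by rewrite FE Dw subrr.
(* F kills the diagonal idempotents, hence it preserves the corner. *)
pose f (m : subvs_of J) : subvs_of J := (F (tri 0 m 0)).1.2.
have corner z : diag 1 0 * z * diag 0 1 = tri 0 z.1.2 0.
  case: (tri_apiP z) => [a [m [b ->]]].
  rewrite !triM -!apiM !rad_lact0 add0r !mulr0 !mul0r linear0 api1.
  by rewrite rad_ract1 // rad_lact1 // -(linear0 (api J)) rad_ract0 addr0.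
have Fm m : F (tri 0 m 0) = tri 0 (f m) 0.
  have e1 : tri 0 m 0 = diag 1 0 * tri 0 m 0 * diag 0 1 by rewrite corner.
  by rewrite [in LHS]e1 !FM !Fd mul0r mulr0 addr0 add0r corner.
have fP : linear f.
  move=> c m n; rewrite /f.
  have -> : tri 0 (c *: m + n) 0 = c *: tri 0 m 0 + tri 0 n 0.
    by rewrite triP scaler0 addr0.
  by rewrite linearP.
have fl a m : f (rad_lact (api J a) m) = rad_lact (api J a) (f m).
  rewrite /f; have -> : tri 0 (rad_lact (api J a) m) 0 = diag a 0 * tri 0 m 0.
    by rewrite triM rad_ract0 addr0 !mulr0.
  by rewrite FM Fd mul0r add0r Fm triM rad_ract0 addr0.
have fr a m : f (rad_ract m (api J a)) = rad_ract (f m) (api J a).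
  rewrite /f; have -> : tri 0 (rad_ract m (api J a)) 0 = tri 0 m 0 * diag 0 a.
    by rewrite triM rad_lact0 add0r !mul0r.
  by rewrite FM Fd mulr0 addr0 Fm triM rad_lact0 add0r.
(* The lift f o p; it is a derivation because p is one and f is A-bilinear. *)
pose q (a : A) : A := vsval (f (vsproj J (vsval p a))).
have qP : linear q.
  by move=> c a b; rewrite /q !linearP fP.
have [d dE] := lfun_of_linear qP.
have dD : d \in Der_rad_vs A.
  apply/Der_radP; split=> [a b|]; last first.
    by apply/subvP => _ /memv_imgP [a _ ->]; rewrite dE subvsP.
  have fD m n : f (m + n) = f m + f n by rewrite -[m]scale1r fP !scale1r.
  have -> : d (a * b) = vsval (f (rad_ract (vsproj J (vsval p a)) (api J b) +
                                  rad_lact (api J a) (vsproj J (vsval p b)))).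
    rewrite dE /q; congr (vsval (f _)); apply: subvs_inj.
    by rewrite vsprojK ?pA // !act_vsvalE // !vsprojK ?pA // der_radM.
  by rewrite fD fr fl !act_vsvalE // !dE.
exists (Subvs dD); apply/InnP; exists w => z.
rewrite add_lfunE opp_lfunE; apply/eqP; rewrite subr_eq addrC -subr_eq -FE.
have [a [m [b ->]]] := tri_apiP z.
have -> : tri (api J a) m (api J b) = diag a b + tri 0 m 0.
  by rewrite triD !addr0 add0r.
rewrite [F _]linearD /= Fd add0r Fm.
have -> : diag a b + tri 0 m 0 = tri (api J a) m (api J b).
  by rewrite triD !addr0 add0r.
rewrite ind_endE /= !dE; apply/eqP; congr tri.
- by apply/esym/eqP; rewrite api_eq0 subvsP.
- by rewrite vsvalK /q pJ ?subvsP // vsvalK.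
- by apply/esym/eqP; rewrite api_eq0 subvsP.
Qed.

(** If the derivation induced by d is the bracket with (s, n, t), then z = s - t
and e = d - [s, -] satisfy the conclusion. *)
Lemma ind_der_ker (d : Der_rad A) : ind_der rad2 xy d \in Inn_vs Sig ->
  exists2 e : Der_rad A, d - e \in Inn_vs A &
    (forall a, vsval e a \in (J : {vspace A})) /\
    exists z, (forall a, z * a - a * z \in (J : {vspace A})) /\
      (forall m, m \in (J : {vspace A}) -> vsval e m = m * z).
Proof.
move=> /InnP [w dw]; have [s [n [t ew]]] := tri_apiP w.
have dwE a (m : subvs_of J) b : [/\ api J (vsval d a) = api J (s * a - a * s),
    vsval d (vsval m) = s * vsval m - vsval m * t
      + (vsval n * b - a * vsval n) &
    api J (vsval d b) = api J (t * b - b * t)].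
  have := dw (tri (api J a) m (api J b)).
  rewrite ind_derE ew !triM triB -!apiM -!(linearB (api J)).
  move=> /tri_inj [-> em ->].
  split=> //; rewrite -vsproj_der em !act_vsvalE //.
  by rewrite [X in _ - X]addrC opprD addrACA.
pose i : Der_rad A := Subvs (ad_Der_rad s).
have iE a : vsval i a = s * a - a * s by rewrite /= add_lfunE opp_lfunE !lfunE.
have eE a : vsval (d - i) a = vsval d a - (s * a - a * s).
  by rewrite -iE add_lfunE opp_lfunE.
exists (d - i); first by rewrite opprB addrC subrK; apply/InnP; exists s.
split=> [a|]; first by rewrite eE -api_eq; have [-> _ _] := dwE a 0 0.
exists (s - t); split=> [a|m mJ].
  have [e1 _ _] := dwE a 0 0; have [_ _ e2] := dwE 0 0 a.
  have -> : (s - t) * a - a * (s - t) = (s * a - a * s) - (t * a - a * t).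
    by rewrite mulrBl mulrBr !opprD !opprK addrACA.
  by rewrite -api_eq -e1 e2.
have [_ + _] := dwE 0 (Subvs mJ) 0; rewrite /= mulr0 mul0r subr0 addr0 eE => ->.
by rewrite mulrBr opprB addrC addrA subrK.
Qed.

Lemma ind_der_ker_comm (d d' : Der_rad A) :
  ind_der rad2 xy d \in Inn_vs Sig -> ind_der rad2 xy d' \in Inn_vs Sig ->
  lie d d' \in Inn_vs A.
Proof.
move=> /ind_der_ker [e de [eJ [z [zc ez]]]].
move=> /ind_der_ker [e' de' [eJ' [z' [zc' ez']]]].
have -> : lie d d' = lie d (d' - e') - lie e' (d - e) + lie e e'.
  rewrite !lieBr (lie_anti e' d) (lie_anti e' e) opprD !opprK.
  by rewrite addrA subrK addrNK.
apply: rpredD; first by apply: rpredB; apply: Inn_ideal.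
apply: (der_rad_inner rad2 xy) => [a|m mJ]; rewrite Der_rad_lieE.
  by apply: rpredB.
have zz : z' * z - z * z' \in (J : {vspace A}) by apply: zc'.
rewrite (ez' m mJ) (ez m mJ).
rewrite (ez (m * z')) ?ideal_mulr // (ez' (m * z)) ?ideal_mulr //.
by rewrite -!mulrA -mulrBr (rad_mul0 rad2 mJ zz).
Qed.

End ImageKernel.

(** The map induced by ind_der on the quotients by inner derivations. *)
Lemma ind_HH1rad (k : fieldType) (A : falgType k)
    (rad2 : (Jrad A ^+ 2)%VS = 0%VS) (I : finType) (x y : I -> A)
    (xy : casimir_mod (Jrad A) x y) :
  exists phi : 'Hom(HH1rad A, HH1rad (Sigma rad2)),
    forall d, phi (lpi (Inn A) d) = lpi (Inn (Sigma rad2)) (ind_der rad2 xy d).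
Proof.
pose g (u : HH1rad A) : HH1rad (Sigma rad2) :=
  lpi (Inn (Sigma rad2)) (ind_der rad2 xy (lrepr u)).
have gE d : g (lpi (Inn A) d) = lpi (Inn (Sigma rad2)) (ind_der rad2 xy d).
  apply/eqP; rewrite -subr_eq0 -linearB /= lpi_eq0.
  set r := lrepr _.
  have -> : ind_der rad2 xy r - ind_der rad2 xy d = ind_der rad2 xy (r - d).
    by rewrite addrC -scaleN1r -ind_der_linear scaleN1r addrC.
  by apply: ind_der_Inn; apply: vpi_repr.
have gP : linear g.
  move=> c u v; rewrite -[u]lreprK -[v]lreprK -linearP !gE.
  by rewrite ind_der_linear linearP.
have [phi phiE] := lfun_of_linear gP; exists phi => d.
by rewrite phiE gE.
Qed.

Theorem corollary3p3 (k : fieldType) (A : falgType k)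
    (A_basic : basic A)
    (rad2 : (Jrad A ^+ 2)%VS = 0%VS)
    (A_sep : separable_algebra (aquot (Jrad A))) :
  (exists phi : 'Hom(HH1rad A, HH1rad (Sigma rad2)),
     [/\ lie_hom phi, limg phi = fullv & lie_solvable (lker phi)]) /\
  (lie_solvable (fullv : {vspace HH1rad (Sigma rad2)}) <->
   lie_solvable (fullv : {vspace HH1rad A})).
Proof.
have [I [x [y xy]]] := separable_casimir A_sep.
have [phi phiE] := ind_HH1rad rad2 xy.
have phi_lie : lie_hom phi.
  move=> u v; rewrite -[u]lreprK -[v]lreprK -lpi_lie !phiE ind_der_lie.
  exact: lpi_lie.
have phi_surj : limg phi = fullv.
  apply/vspaceP => v; rewrite memvf -[v]lreprK.
  have [d dv] := ind_der_surj xy (lrepr v).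
  apply/memv_imgP; exists (lpi (Inn A) d); rewrite ?memvf // phiE.
  by apply/eqP; rewrite -subr_eq0 -linearB lpi_eq0.
have phi_ker : lie_solvable (lker phi).
  exists 1%N; apply/eqP; rewrite -subv0; apply/lie_commP => u v.
  rewrite -[u]lreprK -[v]lreprK !memv_ker !phiE !lpi_eq0 => du dv.
  by rewrite -lpi_lie memv0 lpi_eq0; apply: ind_der_ker_comm du dv.
split; first by exists phi.
exact: lie_solvable_ext phi_lie phi_surj phi_ker.
Qed.
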